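(* Let $m$ be an admissible weight on $X\times X$ and let $\mathcal A$ be an admissible Banach-$*$-algebra of kernels on $X\times X$ which is an $\mathcal A_m$-bimodule with respect to composition. Assume that $\mathcal F=\{\psi_x\}_{x\in X}$ and $\mathcal G=\{\varphi_x\}_{x\in X}$ are two mutually $\mathcal A$-localized continuous frames (i.e. $\mathcal F\sim_{\mathcal A}\mathcal G$) such that $R_{\mathcal F},R_{\mathcal G}\in\mathcal A_m$. Suppose there exists a moderate admissible covering $\mathcal U^\delta=(U_i)_{i\in I}$ of $X$ for which both $\mathcal F$ and $\mathcal G$ possess property $D[\delta,m]$ for some $\delta>0$. Then the discrete systems $\mathcal F_d=\{\psi_{x_i}\}_{i\in I}$ and $\mathcal G_d=\{\varphi_{y_i}\}_{i\in I}$, with $x_i,y_i\in U_i$, are $\mathcal A^\flat$-localized, i.e. $\mathcal F_d\sim_{\mathcal A^\flat}\mathcal G_d$, that is, the matrix $(\langle\varphi_{y_j},\psi_{x_i}\rangle)_{i,j\in I}$ belongs to $\mathcal A^\flat=\mathcal A^\flat(\mathcal U^\delta)$.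
   Context: **Frames.** $\mathcal H$ is a separable Hilbert space (inner product linear in the first slot); $X$ is a locally compact, $\sigma$-compact Hausdorff space with positive Radon measure $\mu$, $\operatorname{supp}\mu=X$. A family $\mathcal F=\{\psi_x\}_{x\in X}\subset\mathcal H$ is a continuous frame if there are $0<C_1,C_2<\infty$ with $C_1\|f\|^2\le\int_X|\langle f,\psi_x\rangle|^2d\mu(x)\le C_2\|f\|^2$ for all $f\in\mathcal H$. Standing: frames are weakly continuous in $x$ and norm bounded, $\sup_x\|\psi_x\|<\infty$. Frame operator: $S_{\mathcal F}f=\int_X\langle f,\psi_x\rangle\psi_x\,d\mu(x)$ (weakly). $R_{\mathcal F}(x,y)=\langle\psi_y,S_{\mathcal F}^{-1}\psi_x\rangle$. **Kernels.** A kernel acts by $K(F)(x)=\int_XF(y)K(x,y)d\mu(y)$; composition is $K_1\circ K_2(x,y)=\int_XK_1(x,z)K_2(z,y)d\mu(z)$, involution $K^*(x,y)=\overline{K(y,x)}$. $\|K|\mathcal A_1\|=\max\{\operatorname{ess\,sup}_x\int|K(x,y)|d\mu(y),\operatorname{ess\,sup}_y\int|K(x,y)|d\mu(x)\}$. A weight $m:X\times X\to\mathbb R$ is admissible if it is continuous, $1\le m(x,y)\le m(x,z)m(z,y)$, $m(x,y)=m(y,x)$ for all $x,y,z$, and $m(x,x)\le C<\infty$. $\mathcal A_m$ is the Banach-$*$-algebra of measurable kernels with $\|K|\mathcal A_m\|=\|Km|\mathcal A_1\|<\infty$. A Banach-$*$-algebra $(\mathcal A,\|\cdot|\mathcal A\|)$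 of kernels on $X\times X$ (with composition $K_1\circ K_2(x,y)=\int_XK_1(x,z)K_2(z,y)d\mu(z)$ as multiplication, the involution $K^*(x,y)=\overline{K(y,x)}$ and the action $K(F)(x)=\int_XF(y)K(x,y)d\mu(y)$ on $F\in L^2(X,\mu)$) is admissible with respect to $(X,\mu)$ if (A1) $\mathcal A$ is continuously embedded into $\mathcal B(L^2(X,\mu))$; (A2) $\mathcal A$ is solid: if $K$ is measurable, $|K|\le|L|$ and $L\in\mathcal A$, then $K\in\mathcal A$ and $\|K|\mathcal A\|\le\|L|\mathcal A\|$. **Localization.** For frames $\mathcal G=\{g_x\}$, $\mathcal F=\{f_x\}$ the crossed Gramian kernel is $G(\mathcal G,\mathcal F)(x,y)=\langle f_y,g_x\rangle$; $\mathcal G\sim_{\mathcal A}\mathcal F$ ($\mathcal G$ is $\mathcal A$-localized with respect to $\mathcal F$) means $G(\mathcal G,\mathcal F)\in\mathcal A$; this relation is symmetric. The same notation is used for discrete systems with matrices $G(\mathcal G_d,\mathcal F_d)_{i,j}$. **Coverings.** A family $\mathcal U=(U_i)_{i\in I}$ of (measurable) subsets is an admissible covering of $X$ if each $U_i$ is relatively compact with non-void interior, $X=\bigcup_iU_i$, and $\sup_{j}\#\{i:U_i\cap U_j\ne\emptyset\}\le N<\infty$. It is moderate if also $\mu(U_i)\ge D>0$ for all $i$ and $\mu(U_i)\le\widetilde C\mu(U_j)$ whenever $U_i\cap U_j\neq\emptyset$. **Property $D[\delta,m]$.** A frame $\mathcal F$ possesses property $D[\delta,m]$ (for the covering $\mathcal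 U$) if $\mathcal U$ is a moderate admissible covering with $\sup_{x,y\in U_i}m(x,y)\le C_{m,\mathcal U}$ for all $i$, and $\operatorname{osc}_{\mathcal U}(x,y):=\sup_{z\in Q_y}|R_{\mathcal F}(x,y)-R_{\mathcal F}(x,z)|$, $Q_y:=\bigcup_{i:\,y\in U_i}U_i$, satisfies $\|\operatorname{osc}_{\mathcal U}|\mathcal A_m\|<\delta$. **Matrix algebra.** For a matrix $\Lambda=(\lambda_{i,j})_{i,j\in I}$ put $\Lambda_{\mathcal U}(x,y)=\sum_{i,j\in I}|\lambda_{i,j}|\chi_{U_i}(x)\chi_{U_j}(y)$. Then $\mathcal A^\flat(\mathcal U)=\{\Lambda:\Lambda_{\mathcal U}\in\mathcal A\}$ with norm $\|\Lambda|\mathcal A^\flat\|=\|\Lambda_{\mathcal U}|\mathcal A\|$ and multiplication $(\Lambda\circ\mathcal E)_{i,j}=\sum_{k\in I}\lambda_{i,k}\epsilon_{k,j}\mu(U_k)$. *)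

(* Defs.v *)
From HB Require Import structures.
From mathcomp Require Import all_boot all_order all_algebra.
From mathcomp Require Import sesquilinear.
From mathcomp Require Export complex.
From mathcomp Require Import all_classical all_reals all_analysis.
From mathcomp Require Import ess_sup_inf.

Set Implicit Arguments.
Unset Strict Implicit.
Unset Printing Implicit Defensive.

Import Order.TTheory GRing.Theory Num.Theory.
Import numFieldNormedType.Exports.

Local Open Scope classical_set_scope.
Local Open Scope ring_scope.
Local Open Scope complex_scope.
Local Open Scope card_scope.

Notation cmod := ComplexField.Normc.normc.

(* [X] with its Borel sigma-algebra; the underlying type is [X] itself. *)
Notation borel X := (g_sigma_algebraType (@open X)).

Section Hilbert.
Context {R : realType} {H : lmodType R[i]}.
(* A form in [{dot H for Num.conj}] is linear in its first slot. *)
Variable ip : {dot H for Num.conj}.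

Definition hnorm (f : H) : R := Num.sqrt (complex.Re (ip f f)).

Definition complete_space : Prop :=
  forall u : nat -> H,
    (forall e : R, 0 < e -> exists N : nat, forall n p : nat,
       (N <= n)%N -> (N <= p)%N -> hnorm (u n - u p) < e) ->
    exists l : H, forall e : R, 0 < e -> exists N : nat, forall n : nat,
       (N <= n)%N -> hnorm (u n - l) < e.

Definition separable_space : Prop :=
  exists D : set H, countable D /\
    forall (f : H) (e : R), 0 < e -> exists2 d, D d & hnorm (f - d) < e.

Definition separable_hilbert : Prop := complete_space /\ separable_space.

(* Used both for families indexed by [X] and for discrete systems. *)
Definition gramian (J : Type) (g f : J -> H) (i j : J) : R[i] := ip (f j) (g i).

Definition localized (J : Type) (A : set (J -> J -> R[i])) (g f : J -> H) :=
  A (gramian g f).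

End Hilbert.

Section ComplexIntegral.
Context {d : measure_display} {T : measurableType d} {R : realType}.
Variable mu : {measure set T -> \bar R}.

Definition cmeasurable (f : T -> R[i]) : Prop :=
  measurable_fun setT (fun t => complex.Re (f t)) /\
  measurable_fun setT (fun t => complex.Im (f t)).

Definition cintegrable (f : T -> R[i]) : Prop :=
  mu.-integrable setT (fun t => (complex.Re (f t))%:E) /\
  mu.-integrable setT (fun t => (complex.Im (f t))%:E).

Definition cintegral (f : T -> R[i]) : R[i] :=
  Rintegral mu setT (fun t => complex.Re (f t)) +i*
  Rintegral mu setT (fun t => complex.Im (f t)).

Definition L2norm (F : T -> R[i]) : \bar R :=
  Lnorm mu 2%:E (fun t => (cmod (F t))%:E).

Definition L2 (F : T -> R[i]) : Prop := cmeasurable F /\ (L2norm F < +oo)%E.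

End ComplexIntegral.

Section Spaces.
Context {R : realType} {X : ptopologicalType}.
Variable mu : {measure set (borel X) -> \bar R}.

Definition sigma_compact : Prop :=
  exists K : nat -> set X, (forall n, compact (K n)) /\ \bigcup_n K n = setT.

Record radon_measure : Prop := RadonMeasure {
  radon_finite : forall K : set X, compact K -> (mu K < +oo)%E;
  radon_outer : forall B : set (borel X), measurable B ->
    mu B = ereal_inf [set mu O | O in [set O : set X | open O /\ B `<=` O]];
  radon_inner : forall O : set X, open O ->
    mu O = ereal_sup [set mu K | K in [set K : set X | compact K /\ K `<=` O]] }.

Definition measure_support : set X :=
  [set x | forall O : set X, open_nbhs x O -> (0 < mu O)%E].

End Spaces.

(* Kernels are functions; equality in a kernel algebra is equality almost
   everywhere for the product measure.  The action and the composition are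
   total functions, so wherever they are used the almost everywhere absolute
   convergence of the defining integral is required as well. *)
Section Kernels.
Context {R : realType} {X : ptopologicalType}.
Variable mu : {measure set (borel X) -> \bar R}.

Local Notation kernel := (X -> X -> R[i]).

Definition measurable_kernel (K : kernel) : Prop :=
  cmeasurable (fun z : borel X * borel X => K z.1 z.2).

Definition kernel_ae (P : X -> X -> Prop) : Prop :=
  almost_everywhere (mu \x mu)%E (fun z : borel X * borel X => P z.1 z.2).

Definition kernel_eq (K L : kernel) : Prop :=
  kernel_ae (fun x y => K x y = L x y).

Definition kernel_zero : kernel := fun _ _ => 0.
Definition kernel_add (K L : kernel) : kernel := fun x y => K x y + L x y.
Definition kernel_scale (a : R[i]) (K : kernel) : kernel := fun x y => a * K x y.
Definition kernel_sub (K L : kernel) : kernel := fun x y => K x y - L x y.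
Definition kernel_star (K : kernel) : kernel := fun x y => (K y x)^*.

Definition composable (K L : kernel) : Prop :=
  kernel_ae (fun x y => cintegrable mu (fun z : borel X => K x z * L z y)).

Definition kernel_comp (K L : kernel) : kernel :=
  fun x y => cintegral mu (fun z : borel X => K x z * L z y).

Definition kernel_act (K : kernel) (F : X -> R[i]) : X -> R[i] :=
  fun x => cintegral mu (fun y : borel X => F y * K x y).

Definition A1norm (K : kernel) : \bar R :=
  maxe
    (ess_sup mu (fun x : borel X => \int[mu]_(y in setT) (cmod (K x y))%:E)%E)
    (ess_sup mu (fun y : borel X => \int[mu]_(x in setT) (cmod (K x y))%:E)%E).

Record admissible_weight (m : X -> X -> R) : Prop := AdmissibleWeight {
  weight_continuous : continuous (fun z : X * X => m z.1 z.2);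
  weight_ge1 : forall x y, 1 <= m x y;
  weight_submult : forall x y z, m x y <= m x z * m z y;
  weight_sym : forall x y, m x y = m y x;
  weight_diag : exists C : R, forall x, m x x <= C }.

Definition Am_norm (m : X -> X -> R) (K : kernel) : \bar R :=
  A1norm (fun x y => K x y * (m x y)%:C).

Definition Am (m : X -> X -> R) : set kernel :=
  [set K | measurable_kernel K /\ (Am_norm m K < +oo)%E].

(* Only the values of [nA] on [A] matter. *)
Record banach_star_algebra (A : set kernel) (nA : kernel -> R) : Prop :=
  BanachStarAlgebra {
  bsa_measurable : forall K, A K -> measurable_kernel K;
  bsa_ae : forall K L, A K -> measurable_kernel L -> kernel_eq K L ->
    A L /\ nA L = nA K;
  bsa_zero : A kernel_zero;
  bsa_add : forall K L, A K -> A L -> A (kernel_add K L);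
  bsa_scale : forall a K, A K -> A (kernel_scale a K);
  bsa_norm_eq0 : forall K, A K -> (nA K = 0 <-> kernel_eq K kernel_zero);
  bsa_norm_add : forall K L, A K -> A L ->
    nA (kernel_add K L) <= nA K + nA L;
  bsa_norm_scale : forall a K, A K -> nA (kernel_scale a K) = cmod a * nA K;
  bsa_complete : forall u : nat -> kernel, (forall n, A (u n)) ->
    (forall e : R, 0 < e -> exists N : nat, forall n p : nat,
       (N <= n)%N -> (N <= p)%N -> nA (kernel_sub (u n) (u p)) < e) ->
    exists2 L, A L & forall e : R, 0 < e -> exists N : nat, forall n : nat,
       (N <= n)%N -> nA (kernel_sub (u n) L) < e;
  bsa_composable : forall K L, A K -> A L -> composable K L;
  bsa_comp : forall K L, A K -> A L -> A (kernel_comp K L);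
  bsa_norm_comp : forall K L, A K -> A L ->
    nA (kernel_comp K L) <= nA K * nA L;
  bsa_compA : forall K L M, A K -> A L -> A M ->
    kernel_eq (kernel_comp (kernel_comp K L) M)
              (kernel_comp K (kernel_comp L M));
  bsa_star : forall K, A K -> A (kernel_star K);
  bsa_norm_star : forall K, A K -> nA (kernel_star K) = nA K }.

Record embedded_in_BL2 (A : set kernel) (nA : kernel -> R) : Prop :=
  EmbeddedInBL2 {
  emb_defined : forall K F, A K -> L2 mu F ->
    almost_everywhere mu
      (fun x : borel X => cintegrable mu (fun y : borel X => F y * K x y));
  emb_L2 : forall K F, A K -> L2 mu F -> L2 mu (kernel_act K F);
  emb_bounded : exists C : R, forall K F, A K -> L2 mu F ->
    (L2norm mu (kernel_act K F) <= (C * nA K)%:E * L2norm mu F)%E;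
  emb_injective : forall K, A K ->
    (forall F, L2 mu F -> almost_everywhere mu
       (fun x : borel X => kernel_act K F x = 0)) ->
    kernel_eq K kernel_zero }.

Definition solid (A : set kernel) (nA : kernel -> R) : Prop :=
  forall K L, measurable_kernel K -> A L ->
    kernel_ae (fun x y => cmod (K x y) <= cmod (L x y)) ->
    A K /\ nA K <= nA L.

Record admissible_algebra (A : set kernel) (nA : kernel -> R) : Prop :=
  AdmissibleAlgebra {
  adm_banach : banach_star_algebra A nA;
  adm_embedded : embedded_in_BL2 A nA;
  adm_solid : solid A nA }.

(* Distributivity needs no field: it follows from additivity of the integral. *)
Record kernel_bimodule (B A : set kernel) : Prop := KernelBimodule {
  bim_composablel : forall K L, B K -> A L -> composable K L;
  bim_composabler : forall K L, A L -> B K -> composable L K;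
  bim_left : forall K L, B K -> A L -> A (kernel_comp K L);
  bim_right : forall K L, A L -> B K -> A (kernel_comp L K);
  bim_leftA : forall K1 K2 L, B K1 -> B K2 -> A L ->
    kernel_eq (kernel_comp (kernel_comp K1 K2) L)
              (kernel_comp K1 (kernel_comp K2 L));
  bim_rightA : forall K1 K2 L, B K1 -> B K2 -> A L ->
    kernel_eq (kernel_comp (kernel_comp L K1) K2)
              (kernel_comp L (kernel_comp K1 K2));
  bim_middleA : forall K1 K2 L, B K1 -> B K2 -> A L ->
    kernel_eq (kernel_comp (kernel_comp K1 L) K2)
              (kernel_comp K1 (kernel_comp L K2)) }.

End Kernels.

Section Frames.
Context {R : realType} {X : ptopologicalType} {H : lmodType R[i]}.
Variable mu : {measure set (borel X) -> \bar R}.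
Variable ip : {dot H for Num.conj}.

Record continuous_frame (psi : X -> H) : Prop := ContinuousFrame {
  frame_weakly_continuous : forall f : H,
    continuous (fun x => complex.Re (ip f (psi x)) : R) /\
    continuous (fun x => complex.Im (ip f (psi x)) : R);
  frame_norm_bounded : exists C : R, forall x, hnorm ip (psi x) <= C;
  frame_bounds : exists C1 C2 : R, [/\ 0 < C1, 0 < C2 & forall f : H,
    ((C1 * hnorm ip f ^+ 2)%:E <=
       \int[mu]_(x in setT) ((cmod (ip f (psi x)) ^+ 2)%:E) /\
     \int[mu]_(x in setT) ((cmod (ip f (psi x)) ^+ 2)%:E) <=
       (C2 * hnorm ip f ^+ 2)%:E)%E] }.

(* For a continuous frame the two sets below are singletons; [xget 0] selects
   their element. *)
Definition frame_operator (psi : X -> H) (f : H) : H :=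
  xget 0 [set h | forall g : H,
    ip h g = cintegral mu (fun x : borel X => ip f (psi x) * ip (psi x) g)].

Definition frame_operator_inv (psi : X -> H) (h : H) : H :=
  xget 0 [set f | frame_operator psi f = h].

Definition frame_kernel (psi : X -> H) (x y : X) : R[i] :=
  ip (psi y) (frame_operator_inv psi (psi x)).

End Frames.

Section Coverings.
Context {R : realType} {X : ptopologicalType} {I : choiceType}.
Variable mu : {measure set (borel X) -> \bar R}.
Variable U : I -> set X.

Record admissible_covering : Prop := AdmissibleCovering {
  cov_measurable : forall i, measurable (U i : set (borel X));
  cov_precompact : forall i, precompact (U i);
  cov_interior : forall i, (U i)° !=set0;
  cov_cover : \bigcup_i U i = setT;
  cov_overlap : exists N : nat, forall j,
    [set i | U i `&` U j !=set0] #<= `I_N }.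

Record moderate_admissible_covering : Prop := ModerateAdmissibleCovering {
  mod_admissible : admissible_covering;
  mod_lower : exists2 D : R, 0 < D & forall i, (D%:E <= mu (U i))%E;
  mod_ratio : exists C : R, forall i j, U i `&` U j !=set0 ->
    (mu (U i) <= C%:E * mu (U j))%E }.

Definition covering_nbhd (y : X) : set X := \bigcup_(i in [set i | U i y]) U i.

(* The supremum is finite for the kernel of a norm bounded frame. *)
Definition osc (K : X -> X -> R[i]) (x y : X) : R[i] :=
  (sup [set cmod (K x y - K x z) | z in covering_nbhd y])%:C.

(* The sum has finitely many nonzero terms when [U] is admissible. *)
Definition matrix_kernel (Lam : I -> I -> R[i]) (x y : X) : R[i] :=
  (\sum_(p \in [set: I * I])
     cmod (Lam p.1 p.2) * \1_(U p.1) x * \1_(U p.2) y)%:C.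

Definition matrix_algebra (A : set (X -> X -> R[i])) : set (I -> I -> R[i]) :=
  [set Lam | A (matrix_kernel Lam)].

Definition property_D {H : lmodType R[i]} (ip : {dot H for Num.conj})
    (delta : R) (m : X -> X -> R) (psi : X -> H) : Prop :=
  [/\ moderate_admissible_covering,
      exists C : R, forall i x y, U i x -> U i y -> m x y <= C,
      Am mu m (osc (frame_kernel mu ip psi)) &
      (Am_norm mu m (osc (frame_kernel mu ip psi)) < delta%:E)%E].

End Coverings.

(* Main.v *)
Require Import Defs.
From mathcomp Require Import all_boot all_order all_algebra.
From mathcomp Require Import sesquilinear.
From mathcomp Require Import all_classical all_reals all_analysis.
From mathcomp Require Import ess_sup_inf measurable_realfun ring lra.

Set Implicit Arguments.
Unset Strict Implicit.
Unset Printing Implicit Defensive.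

Import Order.TTheory GRing.Theory Num.Theory.
Import numFieldNormedType.Exports.

Local Open Scope classical_set_scope.
Local Open Scope ring_scope.
Local Open Scope complex_scope.

(* Write [G(x, y) = <phi_y, psi_x>] and [R_psi], [R_phi] for the frame kernels.
   Inverting the frame operators gives, at every point, the reproducing
   formulas [G = R_psi o G] and [G = G o R_phi].  If [x] lies in the same member
   [U_i] of the covering as [x_i], then, [R_psi] being Hermitian,
   [|R_psi(x_i, z)| = |R_psi(z, x_i)| <= |R_psi(z, x)| + osc(z, x) = K_psi(x, z)],
   and likewise [|R_phi(w, y_j)| <= |R_phi(w, y)| + osc(w, y) = K_phi(w, y)] for
   [y] in [U_j].  Both majorants belong to [A_m].  Sampling one variable at a
   time, [T(z, y) = sum_j |G(z, y_j)| 1_{U_j}(y)] is dominated almost everywhere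
   by a multiple of [|G| o K_phi], and the kernel of the matrix
   [(G(x_i, y_j))] by a multiple of [K_psi o T], because at most [N] members of
   the covering contain a given point; the bimodule property and the solidity
   of [A] conclude.  The index set is countable since [X] is sigma-compact and
   [mu (U_i)] is bounded below, which makes these sums measurable. *)

(* Otherwise hidden by the [measurable_kernel] of mathcomp-analysis, which
   concerns transition kernels. *)
Local Notation measurable_kernel := Defs.measurable_kernel.

(** * Riesz representation for real bilinear forms *)

Section RealForms.
Context {R : realType} {H : lmodType R[i]}.
Implicit Types (b : H -> H -> R) (l : H -> R) (f g h : H) (t : R).

(** Linearity is over the reals although [H] is complex, so that one Riesz argument serves both the
    real part of the inner product and the frame form. *)
Record real_linear l : Prop := RealLinear {
  rlinD : forall f g, l (f + g) = l f + l g;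
  rlinZ : forall t f, l (t%:C *: f) = t * l f }.

Record real_form b : Prop := RealForm {
  rform_sym : forall f g, b f g = b g f;
  rform_lin : forall f, real_linear (b f);
  rform_ge0 : forall f, 0 <= b f f }.

Lemma rlinN l f : real_linear l -> l (- f) = - l f.
Proof.
move=> ll; have -> : - f = (-1)%:C *: f by rewrite rmorphN1 scaleN1r.
by rewrite rlinZ// mulN1r.
Qed.

Lemma rlinB l f g : real_linear l -> l (f - g) = l f - l g.
Proof. by move=> ll; rewrite rlinD// rlinN. Qed.

Lemma rformD b f g : real_form b -> b (f + g) (f + g) = b f f + 2 * b f g + b g g.
Proof.
move=> rb; rewrite rlinD; last exact: rform_lin.
rewrite ![b (f + g) _](rform_sym rb) !(rlinD (rform_lin rb _)).
rewrite (rform_sym rb g f); ring.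
Qed.

Lemma rformZ b t f : real_form b -> b (t%:C *: f) (t%:C *: f) = t ^+ 2 * b f f.
Proof.
move=> rb; rewrite (rlinZ (rform_lin rb _)) rform_sym// (rlinZ (rform_lin rb _)).
by rewrite mulrA expr2.
Qed.

(** For [B > 0] the quadratic is tested at its minimum [t = - a / B]; for [B = 0] it is affine in
    [t], and nonnegativity forces [a = 0]. *)
Lemma quadratic_discr (a B e : R) : 0 <= B -> 0 <= e ->
  (forall t, 0 <= e + 2 * t * a + t ^+ 2 * B) -> a ^+ 2 <= e * B.
Proof.
move=> B0 e0; have [->|BN0] := eqVneq B 0 => Ht.
  have [->|aN0] := eqVneq a 0; first by rewrite expr0n mulr0.
  (* At this [t] the affine function equals [-1]. *)
  have := Ht (- (e + 1) / (2 * a)).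
  have -> : 2 * (- (e + 1) / (2 * a)) * a = - (e + 1) by field.
  rewrite !mulr0 addr0.
  lra.
have B1 : 0 < B by rewrite lt_def BN0.
have := Ht (- a / B).
have -> : e + 2 * (- a / B) * a + (- a / B) ^+ 2 * B = (e * B - a ^+ 2) / B.
  by field.
by rewrite pmulr_lge0 ?invr_gt0// subr_ge0.
Qed.

Lemma rform_CS b f g : real_form b -> b f g ^+ 2 <= b f f * b g g.
Proof.
move=> rb; apply: quadratic_discr; rewrite ?rform_ge0// => t.
have := rform_ge0 rb (f + t%:C *: g).
by rewrite rformD// rformZ// (rlinZ (rform_lin rb _)) mulrA.
Qed.

(* The representing vector minimizes [b f f - 2 l f]. *)
Lemma riesz b l (L : R) : real_form b -> real_linear l ->
  (forall g, l g ^+ 2 <= L * b g g) ->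
  (forall u : nat -> H,
    (forall e : R, 0 < e -> exists N : nat, forall n p : nat,
       (N <= n)%N -> (N <= p)%N -> b (u n - u p) (u n - u p) < e) ->
    exists f, forall e : R, 0 < e -> exists N : nat, forall n : nat,
       (N <= n)%N -> b (u n - f) (u n - f) < e) ->
  exists f, forall g, b f g = l g.
Proof.
move=> rb ll lb bc.
pose J f := b f f - 2 * l f.
have JD f g : J (f + g) = J f + 2 * (b f g - l g) + b g g.
  by rewrite /J rformD// rlinD//; ring.
(* [2 * l f <= |L| + b f f] follows from [l f ^+ 2 <= |L| * b f f] by the arithmetic-geometric mean
   inequality. *)
have Jlb f : - `|L| <= J f.
  rewrite /J; have h0 := rform_ge0 rb f.
  have : l f ^+ 2 <= `|L| * b f f.
    by rewrite (le_trans (lb f))// ler_wpM2r// ler_norm.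
  have := normr_ge0 L; move: `|L| (l f) (b f f) h0 => x y z z0 x0 yxz.
  suff : 2 * y <= x + z by lra.
  have xz0 : 0 <= x + z by rewrite addr_ge0.
  apply: (le_trans (ler_norm _)); rewrite -(ger0_norm xz0) -ler_sqr ?nnegrE//.
  by rewrite !real_normK ?num_real//; have := sqr_ge0 (x - z); nra.
pose E := range J.
have Einf : has_inf E.
  by split; [exists (J 0), 0|exists (- `|L|) => _ [f _ <-]].
pose d := inf E.
have dJ f : d <= J f by apply: ge_inf; [case: Einf|exists f].
have [u uJ] : {u : nat -> H & forall n, J (u n) < d + n.+1%:R^-1}.
  apply: (@choice _ _ (fun n f => J f < d + n.+1%:R^-1)) => n.
   have [_ [f _ <-] Jf] := @inf_adherent _ E n.+1%:R^-1 ltac:(by []) Einf.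
  by exists f.
(* Parallelogram identity: [J] is at least [d] at the midpoint of [f] and [g], so a minimizing
   sequence is Cauchy for [b]. *)
have par f g : b (f - g) (f - g) <= 2 * (J f - d) + 2 * (J g - d).
  have -> : b (f - g) (f - g) = 2 * J f + 2 * J g - 4 * J (2^-1%:C *: (f + g)).
    rewrite /J rformZ// rlinZ// (rlinD ll) !rformD//.
    rewrite !(rlinN _ (rform_lin rb _)) (rform_sym rb (- g)).
    by rewrite !(rlinN _ (rform_lin rb _)); field.
  have := dJ (2^-1%:C *: (f + g)); lra.
have inv_small (e : R) : 0 < e ->
    exists N : nat, forall n, (N <= n)%N -> n.+1%:R^-1 < e.
  move=> e0; exists (Num.truncn e^-1) => n Nn.
  rewrite invf_plt ?posrE// (lt_le_trans (truncnS_gt _))// ler_nat.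
  by rewrite ltnS.
have [f uf] : exists f, forall e : R, 0 < e -> exists N : nat, forall n : nat,
       (N <= n)%N -> b (u n - f) (u n - f) < e.
  apply: bc => e e0; have [N HN] := inv_small (e / 4) ltac:(by rewrite divr_gt0).
  exists N => n p /HN n1 /HN p1; have := par (u n) (u p).
  move: n1 p1 (uJ n) (uJ p); move: (J _) (J _) (n.+1%:R^-1) (p.+1%:R^-1) (b _ _).
  move=> *; lra.
exists f => g.
(* Moving from [u n] along [g] lowers [J] by less than [n.+1%:R^-1]; the discriminant of this
   quadratic in [t] bounds [b (u n) g - l g]. *)
have var n : (b (u n) g - l g) ^+ 2 <= n.+1%:R^-1 * b g g.
  apply: quadratic_discr; rewrite ?rform_ge0// => t.
  have := dJ (u n + t%:C *: g); have := uJ n.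
  rewrite JD rformZ// (rlinZ (rform_lin rb _)) rlinZ//.
  move: (J _) (n.+1%:R^-1) (b _ g) (b g g) (l g) => *; lra.
(* For large [n], both [b (u n) g - b f g] and [b (u n) g - l g] have square at most
   [e / 4 * b g g], and the square of a difference is at most twice the sum of the squares. The
   [1 +] permits division even if [b g g = 0]. *)
have key e : 0 < e -> (b f g - l g) ^+ 2 <= e * (1 + b g g).
  move=> e0; have e4 : 0 < e / 4 by rewrite divr_gt0.
  have [N HN] := inv_small _ e4; have [M HM] := uf _ e4.
  pose n := maxn N M.
  have nN : n.+1%:R^-1 < e / 4 by apply: HN; rewrite leq_maxl.
  have nM : b (u n - f) (u n - f) < e / 4 by apply: HM; rewrite leq_maxr.
  have := var n; have := rform_CS (u n - f) g rb.
  have -> : b (u n - f) g = b (u n) g - b f g.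
    by rewrite !(rform_sym rb _ g) (rlinB _ _ (rform_lin rb g)).
  have g0 := rform_ge0 rb g.
  have : b (u n - f) (u n - f) * b g g <= e / 4 * b g g.
    by rewrite ler_wpM2r// ltW.
  have : n.+1%:R^-1 * b g g <= e / 4 * b g g by rewrite ler_wpM2r// ltW.
  move: (b (u n - f) _ * _) (n.+1%:R^-1 * _) => p q.
  move: (b (u n) g) (b f g) (l g) (b g g) g0 => x y z w w0 h1 h2 h3 h4.
  have : 0 <= ((x - y) + (x - z)) ^+ 2 by apply: sqr_ge0.
  nra.
apply/eqP; rewrite -subr_eq0 -sqrf_eq0 eq_le sqr_ge0 andbT.
apply/ler_addgt0Pr => e e0; rewrite add0r.
have g1 : 0 < 1 + b g g by rewrite ltr_pwDl// rform_ge0.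
by rewrite (le_trans (key (e / (1 + b g g)) _)) ?divr_gt0// divfK// gt_eqF.
Qed.

End RealForms.

(** * Complex-valued integrals *)

Section Cmod.
Context {R : realType}.
Implicit Types (z w : R[i]) (x : R).
Local Notation Re := complex.Re.
Local Notation Im := complex.Im.

Lemma cmod_ge0 z : 0 <= cmod z. Proof. by case: z => a b; exact: sqrtr_ge0. Qed.

Lemma cmod_sqr z : cmod z ^+ 2 = Re z ^+ 2 + Im z ^+ 2.
Proof. by case: z => a b; rewrite sqr_sqrtr// addr_ge0 ?sqr_ge0. Qed.

Lemma normr_Re_le z : `|Re z| <= cmod z.
Proof.
rewrite -ler_sqr ?nnegrE ?cmod_ge0// cmod_sqr real_normK ?num_real//.
by rewrite lerDl sqr_ge0.
Qed.

Lemma normr_Im_le z : `|Im z| <= cmod z.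
Proof.
rewrite -ler_sqr ?nnegrE ?cmod_ge0// cmod_sqr real_normK ?num_real//.
by rewrite lerDr sqr_ge0.
Qed.

Lemma cmod_le z : cmod z <= `|Re z| + `|Im z|.
Proof.
rewrite -ler_sqr ?nnegrE ?cmod_ge0 ?addr_ge0// cmod_sqr sqrrD.
by rewrite !real_normK ?num_real// addrAC lerDl mulrn_wge0// mulr_ge0.
Qed.

Lemma cmodM z w : cmod (z * w) = cmod z * cmod w.
Proof. exact: ComplexField.Normc.normcM. Qed.

Lemma cmod_real x : cmod x%:C = `|x|.
Proof. by rewrite /= expr0n addr0 sqrtr_sqr. Qed.

Lemma Re_mulc z w : Re (z * w) = Re z * Re w - Im z * Im w.
Proof. by case: z => a b; case: w. Qed.

Lemma Im_mulc z w : Im (z * w) = Re z * Im w + Im z * Re w.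
Proof. by case: z => a b; case: w => c d; rewrite /= (mulrC b). Qed.

Lemma Re_conjc z : Re (Num.conj z) = Re z. Proof. by case: z. Qed.
Lemma Im_conjc z : Im (Num.conj z) = - Im z. Proof. by case: z. Qed.
Lemma cmodJ z : cmod (Num.conj z) = cmod z.
Proof. by case: z => a b; rewrite /= sqrrN. Qed.

Lemma complex_ext z w : Re z = Re w -> Im z = Im w -> z = w.
Proof. by case: z => a b; case: w => c d /= -> ->. Qed.

End Cmod.

Section ComplexIntegralTheory.
Context {d : measure_display} {T : measurableType d} {R : realType}.
Variable mu : {measure set T -> \bar R}.
Implicit Types (f g : T -> R[i]) (r : T -> R).
Local Notation Re := complex.Re.
Local Notation Im := complex.Im.

Lemma measurable_cmod f : cmeasurable f ->
  measurable_fun setT (fun t => cmod (f t)).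
Proof.
move=> [mr mi].
rewrite (_ : (fun _ => _) =
  Num.sqrt \o (fun t => Re (f t) ^+ 2 + Im (f t) ^+ 2)); last first.
  by apply/funext => t /=; case: (f t).
apply: measurableT_comp.
  apply: continuous_measurable_fun; exact: sqrt_continuous.
by apply: measurable_funD; exact: measurable_funX.
Qed.

Lemma cmeasurable_real r : measurable_fun setT r -> cmeasurable (fun t => (r t)%:C).
Proof. by move=> mr; split => //=; exact: measurable_cst. Qed.

Lemma cmeasurableM f g : cmeasurable f -> cmeasurable g ->
  cmeasurable (fun t => f t * g t).
Proof.
move=> [fr fi] [gr gi]; split.
- under eq_fun do rewrite Re_mulc.
  by apply: measurable_funB; exact: measurable_funM.
- under eq_fun do rewrite Im_mulc.
  by apply: measurable_funD; exact: measurable_funM.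
Qed.

Lemma cintegrable_dominated f r : cmeasurable f ->
  (forall t, cmod (f t) <= r t) -> mu.-integrable setT (EFin \o r) ->
  cintegrable mu f.
Proof.
move=> [mr mi] fr ir; split; apply: le_integrable ir => //.
- exact/measurable_EFinP.
- move=> t _ /=; rewrite lee_fin (le_trans (normr_Re_le _))//.
  by rewrite (le_trans (fr t))// ler_norm.
- exact/measurable_EFinP.
- move=> t _ /=; rewrite lee_fin (le_trans (normr_Im_le _))//.
  by rewrite (le_trans (fr t))// ler_norm.
Qed.

(* The factor [2] is not sharp: it comes from bounding the real and imaginary
   parts separately. *)
Lemma cmod_cintegral_le f r : cintegrable mu f ->
  (forall t, cmod (f t) <= r t) -> mu.-integrable setT (EFin \o r) ->
  cmod (cintegral mu f) <= 2 * Rintegral mu setT r.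
Proof.
move=> [ifr ifi] fr ir; rewrite (le_trans (cmod_le _))// mulr_natl mulr2n.
have le1 h : mu.-integrable setT (EFin \o h) ->
    (forall t, `|h t| <= cmod (f t)) ->
    `|Rintegral mu setT h| <= Rintegral mu setT r.
  move=> ih hf; rewrite (le_trans (le_normr_Rintegral _ _))//.
  apply: le_Rintegral => //; first exact: integrable_norm.
  by move=> t _; exact: le_trans (fr t).
apply: lerD; apply: le1 => // t; [exact: normr_Re_le|exact: normr_Im_le].
Qed.

(** Phrased with the integral of the squared modulus, the quantity that the frame bounds control. *)
Definition square_integrable f : Prop :=
  cmeasurable f /\ mu.-integrable setT (fun t => (cmod (f t) ^+ 2)%:E).

Lemma square_integrableP f : cmeasurable f ->
  (\int[mu]_(t in setT) (cmod (f t) ^+ 2)%:E < +oo)%E -> square_integrable f.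
Proof.
move=> mf fi; split=> //; apply/integrableP; split.
  exact/measurable_EFinP/measurable_funX/measurable_cmod.
by under eq_integral do rewrite gee0_abs ?lee_fin ?sqr_ge0//.
Qed.

Lemma square_integrable_conj f : square_integrable f ->
  square_integrable (fun t => Num.conj (f t)).
Proof.
move=> [[mr mi] fi]; split; last by under eq_fun do rewrite cmodJ.
split; first by under eq_fun do rewrite Re_conjc.
by under eq_fun do rewrite Im_conjc; exact: measurable_funN.
Qed.

(** The product is dominated by the sum of the squared moduli. *)
Lemma cintegrableM f g : square_integrable f -> square_integrable g ->
  cintegrable mu (fun t => f t * g t).
Proof.
move=> [mf fi] [mg gi].
apply: (@cintegrable_dominated _ (fun t => cmod (f t) ^+ 2 + cmod (g t) ^+ 2)).
- exact: cmeasurableM.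
- move=> t; rewrite cmodM; have := cmod_ge0 (f t); have := cmod_ge0 (g t).
  by move: (cmod _) (cmod _) => x y *; nra.
- exact: (@integrableD _ _ _ mu setT measurableT (fun t => (cmod (f t) ^+ 2)%:E)
    (fun t => (cmod (g t) ^+ 2)%:E)).
Qed.

End ComplexIntegralTheory.

(** * Borel measurability of open, closed and continuous data *)

Section BorelMeasurable.
Context {R : realType} {X : ptopologicalType}.

Lemma open_borel_measurable (A : set X) : open A -> measurable (A : set (borel X)).
Proof. exact: sub_sigma_algebra. Qed.

Lemma closed_borel_measurable (A : set X) :
  closed A -> measurable (A : set (borel X)).
Proof.
by move=> /closed_openC/open_borel_measurable/measurableC; rewrite setCK.
Qed.

Lemma continuous_borel_measurable (f : X -> R) :
  continuous f -> measurable_fun setT (f : borel X -> R).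
Proof.
move=> /continuousP cf; apply: (measurability _ (RGenOpens.measurableE R)).
move=> _ [_ [a [b ->] <-]]; rewrite setTI.
by apply: open_borel_measurable; exact/cf/interval_open.
Qed.

End BorelMeasurable.

(** * The inner product as a real form *)

Section InnerProduct.
Context {R : realType} {H : lmodType R[i]}.
Variable ip : {dot H for Num.conj}.
Implicit Types f g h : H.

Lemma ipC f g : ip f g = Num.conj (ip g f).
Proof. by rewrite hermC expr0 mul1r. Qed.

Lemma re_ip_form : real_form (fun f g => complex.Re (ip f g)).
Proof.
split.
- by move=> f g; rewrite ipC Re_conjc.
- move=> f; split=> [g h|t g]; first by rewrite linearDr raddfD.
  by rewrite linearZr_LR /= Re_mulc /= oppr0 mul0r subr0.
- by move=> f; have := dnorm_ge0 ip f; rewrite lecE => /andP[].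
Qed.

Lemma hnorm_sqr f : hnorm ip f ^+ 2 = complex.Re (ip f f).
Proof. by rewrite sqr_sqrtr// (rform_ge0 re_ip_form). Qed.

Lemma hnorm_ge0 f : 0 <= hnorm ip f. Proof. exact: sqrtr_ge0. Qed.

Lemma ip_inj f f' : (forall g, ip f g = ip f' g) -> f = f'.
Proof.
move=> ff'; apply/eqP; rewrite -subr_eq0 -(dnorm_eq0 ip) linearBl /=.
by rewrite ff' subrr.
Qed.

(** Real Cauchy-Schwarz bounds the real part of [ip f g] and, applied to ['i *: g], its imaginary
    part; adding the two bounds gives the factor [2]. *)
Lemma cmod_ip_le f g : cmod (ip f g) <= 2 * (hnorm ip f * hnorm ip g).
Proof.
have aux h : `|complex.Re (ip f h)| <= hnorm ip f * hnorm ip h.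
  rewrite -ler_sqr ?nnegrE ?mulr_ge0 ?hnorm_ge0// real_normK ?num_real//.
  by rewrite exprMn !hnorm_sqr (rform_CS _ _ re_ip_form).
rewrite (le_trans (cmod_le _))// mulr_natl mulr2n lerD//.
have := aux ('i *: g); rewrite linearZr_LR /= Re_mulc /= mul0r sub0r mulN1r opprK.
by rewrite /hnorm linearZl_LR linearZr_LR /= !Re_mulc !Im_mulc /=
  !(mul0r, mul1r, add0r, sub0r, mulN1r, opprK, addr0).
Qed.

End InnerProduct.

(** * Frame operators and the reproducing formula *)

Section FrameTheory.
Context {R : realType} {X : ptopologicalType} {H : lmodType R[i]}.
Variable mu : {measure set (borel X) -> \bar R}.
Variable ip : {dot H for Num.conj}.
Hypothesis completeH : complete_space ip.
Variable psi : X -> H.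
Hypothesis frame_psi : continuous_frame mu ip psi.
Implicit Types f g h : H.

Lemma frame_square_integrable f :
  square_integrable mu (fun z : borel X => ip f (psi z)).
Proof.
apply: square_integrableP.
  have [cr ci] := frame_weakly_continuous frame_psi f.
  by split; exact: continuous_borel_measurable.
have [C1 [C2 [_ _ /(_ f)[_ C2f]]]] := frame_bounds frame_psi.
by rewrite (le_lt_trans C2f)// ltry.
Qed.

Lemma frame_square_integrable_r g :
  square_integrable mu (fun z : borel X => ip (psi z) g).
Proof.
under [X in square_integrable _ X]eq_fun do rewrite ipC.
exact/square_integrable_conj/frame_square_integrable.
Qed.

Lemma frame_cintegrable f g :
  cintegrable mu (fun z : borel X => ip f (psi z) * ip (psi z) g).
Proof.
exact: cintegrableM (frame_square_integrable f) (frame_square_integrable_r g).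
Qed.

(** The real part of [<S f, g>] for the frame operator [S], given as an integral because the
    existence of [S] is deduced from it. *)
Definition frame_form f g : R :=
  complex.Re (cintegral mu (fun z : borel X => ip f (psi z) * ip (psi z) g)).

Lemma frame_form_real : real_form frame_form.
Proof.
have ire f g := (frame_cintegrable f g).1.
split.
- move=> f g; rewrite /frame_form /=; apply: eq_Rintegral => z _ /=.
  rewrite (ipC _ (psi z) g) (ipC _ f) !Re_mulc Re_conjc Im_conjc Re_conjc Im_conjc.
  by rewrite mulrN opprK mulNr mulrC; congr (_ + _); rewrite mulrC.
- move=> f; split=> [g h|t g]; rewrite /frame_form /=.
    rewrite -RintegralD//; [|exact: ire..]; apply: eq_Rintegral => z _ /=.
    by rewrite linearDr mulrDr raddfD.
  rewrite -RintegralZl//; [|exact: ire]; apply: eq_Rintegral => z _ /=.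
  by rewrite linearZr_LR /= !Re_mulc !Im_mulc /=; ring.
- move=> f; rewrite /frame_form /=; apply: Rintegral_ge0 => z _ /=.
  rewrite (ipC _ (psi z)) Re_mulc Re_conjc Im_conjc mulrN opprK.
  by rewrite addr_ge0// -expr2 sqr_ge0.
Qed.

Lemma frame_form_diag f :
  ((frame_form f f)%:E =
    \int[mu]_(z in setT) (cmod (ip f (psi z)) ^+ 2)%:E)%E.
Proof.
rewrite /frame_form /= /Rintegral fineK; last first.
  apply: integrable_fin_num => //; exact: (frame_cintegrable f f).1.
apply: eq_integral => z _; congr EFin.
by rewrite (ipC _ (psi z)) Re_mulc Re_conjc Im_conjc mulrN opprK cmod_sqr !expr2.
Qed.

Lemma frame_form_bounds : exists C1 C2 : R, [/\ 0 < C1, 0 < C2 & forall f,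
  C1 * complex.Re (ip f f) <= frame_form f f /\
  frame_form f f <= C2 * complex.Re (ip f f)].
Proof.
have [C1 [C2 [C10 C20 C12]]] := frame_bounds frame_psi.
exists C1, C2; split=> // f; have := C12 f.
by rewrite -frame_form_diag !lee_fin !hnorm_sqr.
Qed.

Lemma re_ip_complete (u : nat -> H) :
  (forall e : R, 0 < e -> exists N : nat, forall n p : nat,
    (N <= n)%N -> (N <= p)%N -> complex.Re (ip (u n - u p) (u n - u p)) < e) ->
  exists f, forall e : R, 0 < e -> exists N : nat, forall n : nat,
    (N <= n)%N -> complex.Re (ip (u n - f) (u n - f)) < e.
Proof.
have sqrt_lt f (e : R) : 0 < e ->
    (complex.Re (ip f f) < e ^+ 2) = (hnorm ip f < e).
  by move=> e0; rewrite -hnorm_sqr ltr_sqr ?nnegrE ?hnorm_ge0// ltW.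
move=> uC; have [e e0|f uf] := @completeH u.
  have [N HN] := uC (e ^+ 2) (exprn_gt0 _ e0).
  by exists N => n p nN pN; rewrite -sqrt_lt//; exact: HN.
exists f => e e0; have [|N HN] := uf (Num.sqrt e); first by rewrite sqrtr_gt0.
exists N => n nN; rewrite -[ltRHS]sqr_sqrtr ?ltW// sqrt_lt ?sqrtr_gt0//.
exact: HN.
Qed.

(** The lower frame bound turns Cauchy sequences for the form into Cauchy sequences of [H]; the
    upper one carries the limit back to the form. *)
Lemma frame_form_complete (u : nat -> H) :
  (forall e : R, 0 < e -> exists N : nat, forall n p : nat,
    (N <= n)%N -> (N <= p)%N -> frame_form (u n - u p) (u n - u p) < e) ->
  exists f, forall e : R, 0 < e -> exists N : nat, forall n : nat,
    (N <= n)%N -> frame_form (u n - f) (u n - f) < e.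
Proof.
have [C1 [C2 [C10 C20 C12]]] := frame_form_bounds.
move=> uC; have [e e0|f uf] := @re_ip_complete u.
  have [N HN] := uC (C1 * e) (mulr_gt0 C10 e0).
  exists N => n p nN pN; rewrite -(ltr_pM2l C10).
  by rewrite (le_lt_trans (C12 _).1)// HN.
exists f => e e0; have [|N HN] := uf (e / C2); first by rewrite divr_gt0.
exists N => n nN; rewrite (le_lt_trans (C12 _).2)// mulrC -ltr_pdivlMr//.
exact: HN.
Qed.

(* Replacing [g] by [i g] recovers the imaginary parts. *)
Lemma frame_form_ext h f : (forall g, complex.Re (ip h g) = frame_form f g) ->
  forall g, ip h g = cintegral mu (fun z : borel X => ip f (psi z) * ip (psi z) g).
Proof.
move=> hf g; apply: complex_ext; first exact: hf.
have := hf ('i *: g); rewrite linearZr_LR /= Re_mulc /=.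
rewrite mul0r sub0r mulN1r opprK => ->; apply: eq_Rintegral => z _ /=.
by rewrite linearZr_LR /= !Re_mulc !Im_mulc /=; ring.
Qed.

Lemma frame_operator_eq f h :
  (forall g, ip h g =
    cintegral mu (fun z : borel X => ip f (psi z) * ip (psi z) g)) ->
  frame_operator mu ip psi f = h.
Proof.
move=> hf; apply: (@ip_inj _ _ ip) => g; rewrite hf.
rewrite /frame_operator; set S := [set _ | _].
suff : S (xget 0 S) by apply.
exact: (xgetI _ (hf : S h)).
Qed.

(** Riesz for the real part of [ip]: the functional [frame_form f] is bounded by Cauchy-Schwarz and
    the upper frame bound, so [xget] selects from a nonempty set. *)
Lemma frame_operatorE f g : ip (frame_operator mu ip psi f) g =
  cintegral mu (fun z : borel X => ip f (psi z) * ip (psi z) g).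
Proof.
have [C1 [C2 [C10 C20 C12]]] := frame_form_bounds.
have [h hf] : exists h, forall g, complex.Re (ip h g) = frame_form f g.
  apply: (riesz (L := C2 * frame_form f f) (re_ip_form ip)
    (rform_lin frame_form_real f) _ re_ip_complete).
  move=> k; rewrite (le_trans (rform_CS f k frame_form_real))//.
  rewrite -mulrA mulrCA ler_wpM2l ?(rform_ge0 frame_form_real)//.
  exact: (C12 k).2.
by rewrite (@frame_operator_eq f h) ?(frame_form_ext hf)//; exact: frame_form_ext.
Qed.

(** Surjectivity of the frame operator, by Riesz with [frame_form] as inner product: the lower frame
    bound makes the real part of [ip h] bounded for it. *)
Lemma frame_operator_invK h :
  frame_operator mu ip psi (frame_operator_inv mu ip psi h) = h.
Proof.
have [C1 [C2 [C10 C20 C12]]] := frame_form_bounds.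
have [f fh] : exists f, forall g, frame_form f g = complex.Re (ip h g).
  apply: (riesz (L := C1^-1 * complex.Re (ip h h)) frame_form_real
    (rform_lin (re_ip_form ip) h) _ frame_form_complete).
  move=> k; rewrite (le_trans (rform_CS h k (re_ip_form ip)))//.
  rewrite -mulrA mulrCA ler_wpM2l ?(rform_ge0 (re_ip_form ip))//.
  by rewrite mulrC ler_pdivlMr// mulrC; exact: (C12 k).1.
have fE : frame_operator mu ip psi f = h.
  by apply: frame_operator_eq; apply: frame_form_ext => g; rewrite fh.
rewrite /frame_operator_inv; set S := [set _ | _].
exact: (xgetI _ (fE : S f)).
Qed.

Lemma frame_inversion h g : ip h g = cintegral mu (fun z : borel X =>
  ip (frame_operator_inv mu ip psi h) (psi z) * ip (psi z) g).
Proof. by rewrite -frame_operatorE frame_operator_invK. Qed.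

Local Notation K := (frame_kernel mu ip psi).
Local Notation S' := (frame_operator_inv mu ip psi).

(** Self-adjointness of the inverse frame operator: [frame_inversion] expands [K x y] and [K y x]
    into integrals with conjugate integrands. *)
Lemma frame_kernel_herm x y : K x y = Num.conj (K y x).
Proof.
rewrite /frame_kernel (frame_inversion (psi y) (S' (psi x))).
rewrite (frame_inversion (psi x) (S' (psi y))).
apply: complex_ext; rewrite ?Re_conjc ?Im_conjc /=.
  apply: eq_Rintegral => z _; rewrite (ipC _ (psi z)) (ipC _ (S' (psi y))).
  by rewrite !Re_mulc !Re_conjc !Im_conjc; ring.
rewrite -mulN1r -RintegralZl//; last exact: (frame_cintegrable _ _).2.
apply: eq_Rintegral => z _; rewrite (ipC _ (psi z)) (ipC _ (S' (psi y))).
by rewrite !Im_mulc !Re_conjc !Im_conjc; ring.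
Qed.

(** The inversion formula rewritten with the Hermitian kernel. It holds at every [y], not just
    almost everywhere, which permits sampling. *)
Lemma frame_reproducing y g : ip (psi y) g =
  cintegral mu (fun w : borel X => K w y * ip (psi w) g).
Proof.
rewrite (frame_inversion (psi y) g); congr cintegral; apply/funext => w.
by rewrite frame_kernel_herm /frame_kernel -ipC.
Qed.

Lemma frame_kernel_cintegrable y g :
  cintegrable mu (fun w : borel X => K w y * ip (psi w) g).
Proof.
rewrite (_ : (fun _ => _) = (fun w => ip (S' (psi y)) (psi w) * ip (psi w) g)).
  exact: frame_cintegrable.
by apply/funext => w; rewrite frame_kernel_herm /frame_kernel -ipC.
Qed.

(** Makes the set in the definition of [osc] bounded, so that its [sup] is a true supremum. *)
Lemma frame_kernel_bounded x : exists C : R, forall y, cmod (K x y) <= C.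
Proof.
have [C psiC] := frame_norm_bounded frame_psi.
exists (2 * (C * hnorm ip (S' (psi x)))) => y.
rewrite (le_trans (cmod_ip_le _ _ _))// ler_pM2l// ler_wpM2r ?hnorm_ge0//.
Qed.

End FrameTheory.

(** * Weighted kernels *)

Section WeightedKernels.
Context {R : realType} {X : ptopologicalType}.
Variable mu : {measure set (borel X) -> \bar R}.
Implicit Types (K L : X -> X -> R[i]) (m : X -> X -> R).

Lemma measurable_kernel_transpose K :
  measurable_kernel K -> measurable_kernel (fun x y => K y x).
Proof.
move=> [mr mi].
have ms := @measurable_swap _ _ (borel X) (borel X).
split; [exact: (measurableT_comp mr ms)|exact: (measurableT_comp mi ms)].
Qed.

Lemma measurable_kernel_section1 K x :
  measurable_kernel K -> cmeasurable (fun y : borel X => K x y).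
Proof.
move=> [mr mi]; split.
- exact: (@measurable_fun_pair2 _ _ _ (borel X) (borel X) R _ x mr).
- exact: (@measurable_fun_pair2 _ _ _ (borel X) (borel X) R _ x mi).
Qed.

Lemma A1norm_lty K : (A1norm mu K < +oo)%E =
  (ess_sup mu (fun x : borel X =>
     \int[mu]_(y in setT) (cmod (K x y))%:E)%E < +oo)%E &&
  (ess_sup mu (fun y : borel X =>
     \int[mu]_(x in setT) (cmod (K x y))%:E)%E < +oo)%E.
Proof. exact: gt_max. Qed.

Lemma A1norm_transpose K : A1norm mu (fun x y => K y x) = A1norm mu K.
Proof. exact: maxC. Qed.

Lemma Am_transpose m K : admissible_weight m ->
  Am mu m K -> Am mu m (fun x y => K y x).
Proof.
move=> hm [mK nK]; split; first exact: measurable_kernel_transpose.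
move: nK; rewrite /Am_norm -A1norm_transpose.
by under [in X in _ -> X]eq_fun do under eq_fun do rewrite (weight_sym hm).
Qed.

(** Integrals over sections add and [ess_sup] is subadditive. Moduli are summed because the result
    serves as a majorant. *)
Lemma Am_add_cmod m K L : admissible_weight m -> Am mu m K -> Am mu m L ->
  Am mu m (fun x y => (cmod (K x y) + cmod (L x y))%:C).
Proof.
move=> hm AK AL; have [mK nK] := AK; have [mL nL] := AL.
have msec (M : X -> X -> R[i]) (mM : measurable_kernel M) (x : X) :
    measurable_fun setT (fun y : borel X => (cmod (M x y * (m x y)%:C))%:E).
  apply/measurable_EFinP/measurable_cmod/cmeasurableM.
    exact: measurable_kernel_section1.
  apply: cmeasurable_real; apply: (@continuous_borel_measurable _ _ (m x)) => y.
  apply: (@continuous_comp _ _ _ (fun y => (x, y)) (fun z => m z.1 z.2)).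
    by apply: cvg_pair; [exact: cvg_cst|exact: cvg_id].
  exact: weight_continuous hm _.
have bound (M N : X -> X -> R[i]) (mM : measurable_kernel M)
    (mN : measurable_kernel N) :
  (ess_sup mu (fun x : borel X =>
     \int[mu]_(y in setT) (cmod (M x y * (m x y)%:C))%:E)%E < +oo)%E ->
  (ess_sup mu (fun x : borel X =>
     \int[mu]_(y in setT) (cmod (N x y * (m x y)%:C))%:E)%E < +oo)%E ->
  (ess_sup mu (fun x : borel X => \int[mu]_(y in setT)
     (cmod ((cmod (M x y) + cmod (N x y))%:C * (m x y)%:C))%:E)%E < +oo)%E.
  have E x y : cmod ((cmod (M x y) + cmod (N x y))%:C * (m x y)%:C) =
      cmod (M x y * (m x y)%:C) + cmod (N x y * (m x y)%:C).
    rewrite !cmodM !cmod_real -mulrDl.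
    by rewrite (@ger0_norm _ (cmod _ + cmod _))// addr_ge0 ?cmod_ge0.
  move=> eM eN; have := lte_add_pinfty eM eN; apply: le_lt_trans.
  apply: le_trans (ess_supD _ _ _); apply: le_ess_sup; apply: nearW => x.
  have c0 (M' : X -> X -> R[i]) (y : borel X) :
      setT y -> (0 <= (cmod (M' x y * (m x y)%:C))%:E)%E.
    by rewrite lee_fin cmod_ge0.
  have := @ge0_integralD _ _ _ mu setT measurableT _ _ (c0 M) (msec M mM x)
    (c0 N) (msec N mN x).
  move=> /= <-.
  rewrite le_eqVlt; apply/orP; left; apply/eqP; apply: eq_integral => y _.
  by rewrite -EFinD; congr EFin; exact: E.
(* Symmetry of [m] turns column integrals into row integrals of the transposed kernel, so [bound]
   covers both halves of the norm. *)
have trans (M : X -> X -> R[i]) : (fun y : borel X =>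
    \int[mu]_(x in setT) (cmod (M x y * (m x y)%:C))%:E)%E =
    (fun y : borel X => \int[mu]_(x in setT) (cmod (M x y * (m y x)%:C))%:E)%E.
  by apply/funext => y; apply: eq_integral => x _; rewrite (weight_sym hm).
move: nK nL; rewrite /Am_norm !A1norm_lty => /andP[K1 K2] /andP[L1 L2].
split; first by apply/cmeasurable_real/measurable_funD; exact: measurable_cmod.
rewrite /Am_norm A1norm_lty; apply/andP; split; first exact: bound.
rewrite (trans (fun x y => (cmod (K x y) + cmod (L x y))%:C)).
apply: (bound (fun x y => K y x) (fun x y => L y x));
  try exact: measurable_kernel_transpose; by rewrite -trans.
Qed.

End WeightedKernels.

(** * Coverings *)

Local Open Scope card_scope.

(** * Finitely supported sums: counting bounds and measurability *)

Section FiniteSupportSums.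
Context {R : realType} {J : choiceType}.
Implicit Types (A P : set J) (F : J -> R).

(** Only indices in both [P] and [A] contribute, and there are at most [M] of them, even for
    infinite [P]. *)
Lemma fsbig_le_card F A P (M : nat) (c : R) : A #<= `I_M -> 0 <= c ->
  (forall j, A j -> F j <= c) -> (forall j, ~ A j -> F j = 0) ->
  \sum_(j \in P) F j <= M%:R * c.
Proof.
move=> AM c0 Fc F0; have APM : P `&` A #<= `I_M.
  by apply: card_le_trans AM; apply: subset_card_le => j [].
have finA : finite_set (P `&` A).
  by apply: card_le_finite APM _; exact: finite_II.
rewrite -(@fsbig_widen _ _ _ _ (P `&` A))//; last first.
  by move=> j [Pj nPAj]; apply: F0 => Aj; exact: nPAj.
rewrite fsbig_finite//=.
rewrite (@le_trans _ _ (\sum_(j <- finmap.enum_fset (fset_set (P `&` A))) c))//.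
  rewrite big_seq [leRHS]big_seq; apply: ler_sum => j.
  by rewrite in_fset_set// inE => -[_]; exact: Fc.
rewrite big_const_seq iter_addr_0 count_predT mulr_natl.
by apply: ler_wpMn2l => //; exact: geq_card_fset_set.
Qed.

Lemma le_fsbig F A j : finite_set A -> (forall i, 0 <= F i) ->
  (forall i, ~ A i -> F i = 0) -> F j <= \sum_(i \in [set: J]) F i.
Proof.
move=> finA F0 FA; have [Aj|nAj] := pselect (A j); last first.
  by rewrite FA//; apply: fsumr_ge0.
rewrite -(@fsbig_widen _ _ _ _ A)//; last by move=> i [_]; exact: FA.
by rewrite (fsbigD1 j)//= lerDl; apply: fsumr_ge0.
Qed.

(** Pointwise limit of finite partial sums along an injection of [J] into the naturals; at each
    point they are eventually constant. *)
Lemma measurable_fsbig (d : measure_display) (T : measurableType d)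
    (f : J -> T -> R) : countable [set: J] ->
  (forall j, measurable_fun setT (f j)) ->
  (forall t, finite_set [set j | f j t != 0]) ->
  measurable_fun setT (fun t => \sum_(j \in [set: J]) f j t).
Proof.
move=> /countable_injP[g ginj] mf suppf.
pose B n := [set j | (g j < n)%N].
have finB n : finite_set (B n).
  apply: (@finite_preimage _ _ `I_n g) => //.
  by move=> x y _ _; apply: ginj; rewrite inE.
apply: (@measurable_fun_cvg _ _ _ setT (fun n t => \sum_(j \in B n) f j t)).
  move=> n; under eq_fun do rewrite fsbig_finite//=.
  exact: measurable_sum.
move=> t _; apply: cvg_near_cst.
have /finite_fsetP[D Dsupp] := suppf t.
(* The successor is taken because [B n] is cut off by a strict inequality. *)
exists (\max_(j <- finmap.enum_fset D) g j).+1 => // n /= nD.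
apply: fsbig_widen => // j [_ nBj] /=; apply/eqP/negP => /negP fj.
apply: nBj; rewrite /B /=; apply: leq_trans nD; rewrite ltnS.
have : [set j | f j t != 0] j by [].
by rewrite Dsupp => jD; apply: leq_bigmax_seq.
Qed.

End FiniteSupportSums.

(** * Overlap and countability of coverings *)

Section CoveringTheory.
Context {R : realType} {X : ptopologicalType} {I : choiceType}.
Variable mu : {measure set (borel X) -> \bar R}.
Variable U : I -> set X.

Lemma covering_overlap : admissible_covering U ->
  exists N : nat, forall y, [set i | U i y] #<= `I_N.
Proof.
move=> aU; have [N HN] := cov_overlap aU; exists N => y.
have : (\bigcup_i U i) y by rewrite (cov_cover aU).
move=> [j _ Ujy]; apply: card_le_trans (HN j).
by apply: subset_card_le => i /= Uiy; exists y.
Qed.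

(* The indicators of the [U i] add up to at most [N], so the measures of the
   [U i `&` K] add up to at most [N * mu K]. *)
Lemma covering_finite (N : nat) (K : set (borel X)) (e : R) :
  (forall i, measurable (U i : set (borel X))) ->
  (forall y, [set i | U i y] #<= `I_N) ->
  measurable K -> (mu K < +oo)%E -> 0 < e ->
  finite_set [set i | (e%:E <= mu (U i `&` K))%E].
Proof.
move=> mU UN mK Kfin e0; apply: contrapT => infJ.
have K0 : 0 <= fine (mu K) by rewrite fine_ge0.
(* Chosen so that [n.+1 * e] exceeds [N * mu K]: [n.+1] members with measure at least [e] inside [K]
   contradict the overlap bound. *)
pose n := Num.truncn (N%:R * fine (mu K) / e).
have [B BJ Bn] := infinite_set_fset n.+1 infJ.
have mUK i : measurable (U i `&` K : set (borel X)) by apply: measurableI.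
have lb : ((n.+1%:R * e)%:E <=
    \sum_(i <- finmap.enum_fset B) mu (U i `&` K))%E.
  apply: (@le_trans _ _ (\sum_(i <- finmap.enum_fset B) e%:E)%E); last first.
    by rewrite big_seq [leRHS]big_seq; apply: lee_sum => i; exact: BJ.
  rewrite sumEFin lee_fin big_const_seq iter_addr_0 count_predT mulr_natl.
  by apply: ler_wpMn2l => //; exact: ltW.
have ub : (\sum_(i <- finmap.enum_fset B) mu (U i `&` K) <= N%:R%:E * mu K)%E.
  have -> : (\sum_(i <- finmap.enum_fset B) mu (U i `&` K))%E =
     (\int[mu]_(y in setT)
       \sum_(i <- finmap.enum_fset B) (\1_(U i `&` K) y)%:E)%E.
    rewrite ge0_integral_sum//.
      by apply: eq_bigr => i _; rewrite integral_indic// setIT.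
    by move=> i; apply/measurable_EFinP; exact: measurable_indic.
  have -> : (N%:R%:E * mu K)%E =
      (\int[mu]_(y in setT) (N%:R * \1_K y)%:E)%E.
    under eq_integral do rewrite EFinM.
    rewrite ge0_integralZl_EFin//; first by rewrite integral_indic// setIT.
    by apply/measurable_EFinP; exact: measurable_indic.
  have mind (V : set (borel X)) : measurable V ->
      measurable_fun setT (\1_V : borel X -> R) by exact: measurable_indic.
  apply: (ge0_le_integral mu measurableT).
  - by move=> y _; apply: sume_ge0 => i _; rewrite lee_fin.
  - by apply: emeasurable_sum => i; apply/measurable_EFinP; apply: mind.
  - apply/measurable_EFinP; apply: measurable_funM; last exact: mind.
    exact: measurable_cst.
  move=> y _; rewrite sumEFin lee_fin.
  have [Ky|nKy] := pselect (K y); last first.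
    rewrite big1 ?mulr_ge0// => i _; rewrite indicE memNset//.
    by case.
  rewrite [X in _ <= _ * X]indicE mem_set//=.
  rewrite (fsbig_seq _ _ (finmap.fset_uniq B)).
  apply: (fsbig_le_card (A := [set i | U i y])) => // i.
    by rewrite indicE => _; case: (_ \in _).
  by move=> /= nUiy; rewrite indicE memNset// => -[].
rewrite leNgt in lb.
have : ((N%:R * fine (mu K))%:E < (n.+1%:R * e)%:E)%E.
  by rewrite lte_fin -ltr_pdivrMr// truncnS_gt.
rewrite EFinM fineK; last by rewrite ge0_fin_numE.
by move=> /(le_lt_trans ub); exact/negP.
Qed.

(** Each [U i] has positive measure, hence meets some compact [K n] in measure at least [1 / k.+1]
    for some [k]; for given [n] and [k] only finitely many [i] do so. *)
Lemma covering_countable : hausdorff_space X -> @sigma_compact X ->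
  radon_measure mu -> moderate_admissible_covering mu U -> countable [set: I].
Proof.
move=> hX [K [cK KX]] radon [aU [D D0 UD] _].
have [N HN] := covering_overlap aU.
have mK n : measurable (K n : set (borel X)).
  by apply: closed_borel_measurable; exact: compact_closed.
have mUK i n : measurable (U i `&` K n : set (borel X)).
  by apply: measurableI => //; exact: cov_measurable.
pose J n k := [set i | ((k.+1%:R^-1)%:E <= mu (U i `&` K n))%E].
have cJ n k : countable (J n k).
  apply: finite_set_countable; apply: (@covering_finite N) => //.
    exact: cov_measurable.
  by apply: radon_finite radon _ _.
have : countable (\bigcup_n \bigcup_k J n k).
  by apply: bigcup_countable => // n _; apply: bigcup_countable.
suff -> : \bigcup_n \bigcup_k J n k = [set: I] by [].
apply/seteqP; split=> // i _.
(* Otherwise [U i] is a countable union of null sets, against the lower bound [D]. *)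
have [n UKn] : exists n, (0 < mu (U i `&` K n))%E.
  apply: contrapT => /forallNP nU.
  have : mu (\bigcup_n (U i `&` K n)) = 0%E.
    apply: measure_negligible; first exact: bigcup_measurable.
    apply: negligible_bigcup => n; apply/negligibleP => //; apply/eqP.
    by rewrite eq_le measure_ge0 andbT leNgt; apply/negP/nU.
  rewrite -setI_bigcupr KX setIT => U0; have := UD i.
  by rewrite U0 lee_fin leNgt D0.
exists n => //; have [k Hk] : exists k : nat, (k.+1%:R^-1%:E <= mu (U i `&` K n))%E.
  move: UKn; move: (mu _) => [r| |] //=; last by exists 0%N; rewrite leey.
  rewrite lte_fin => r0; exists (Num.truncn r^-1).
  by rewrite lee_fin -[leRHS]invrK lef_pV2 ?posrE ?invr_gt0// ltW// truncnS_gt.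
by exists k.
Qed.

End CoveringTheory.

(** * Localization of the sampled Gramian *)

Section Localization.
Context {R : realType} {X : ptopologicalType} {H : lmodType R[i]}.
Variable mu : {measure set (borel X) -> \bar R}.
Variable ip : {dot H for Num.conj}.
Hypothesis completeH : complete_space ip.
Context {I : choiceType}.
Variable U : I -> set X.

Lemma kernel_ae_mono (P Q : X -> X -> Prop) :
  (forall x y, P x y -> Q x y) -> kernel_ae mu P -> kernel_ae mu Q.
Proof.
move=> PQ [N [mN N0 PN]]; exists N; split=> // z nQz.
by apply: PN => /PQ.
Qed.

(* [osc] bounds the variation of the second variable over the members of the
   covering containing it, so this kernel dominates [K w y'] for every [y']
   sharing a member with [y]. *)
Definition osc_majorant (K : X -> X -> R[i]) (w y : X) : R[i] :=
  (cmod (K w y) + cmod (osc U K w y))%:C.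

(** Triangle inequality through [K w y]: both points lie in [U j], so [y'] takes part in the
    supremum defining [osc] at [y]. *)
Lemma osc_majorantP (psi : X -> H) (frame_psi : continuous_frame mu ip psi)
    (j : I) (w y y' : X) : U j y -> U j y' ->
  cmod (frame_kernel mu ip psi w y') <=
  complex.Re (osc_majorant (frame_kernel mu ip psi) w y).
Proof.
move=> Ujy Ujy'; set K := frame_kernel mu ip psi.
have [C KC] := frame_kernel_bounded frame_psi w.
have dK : cmod (K w y - K w y') <= cmod (osc U K w y).
  rewrite /osc cmod_real (le_trans _ (ler_norm _))//; apply: ub_le_sup.
    exists (C + C) => _ [z _ <-]; rewrite (le_trans (le_normcD _ _))//.
    by rewrite normcN lerD.
  by exists y' => //; exists j.
rewrite /osc_majorant /= -[K w y'](subKr (K w y)).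
rewrite (le_trans (le_normcD _ _))//.
by rewrite normcN lerD2l.
Qed.

Lemma osc_majorant_Am (delta : R) (m : X -> X -> R) (psi : X -> H) :
  admissible_weight m -> Am mu m (frame_kernel mu ip psi) ->
  property_D mu U ip delta m psi ->
  Am mu m (osc_majorant (frame_kernel mu ip psi)).
Proof. by move=> hm RA [_ _ oscA _]; exact: Am_add_cmod. Qed.

(** Reproducing formula at [y'], with the kernel replaced by its majorant at [y] and [ip (psi w) g]
    by [r w]. The nonnegative integral is kept as the modulus of a complex one, to match
    [kernel_comp]. *)
Lemma frame_pointwise_le (psi : X -> H) (frame_psi : continuous_frame mu ip psi)
    (j : I) (y y' : X) (g : H) (r : X -> R) : U j y -> U j y' ->
  (forall w, cmod (ip (psi w) g) <= r w) ->
  cintegrable mu (fun w : borel X =>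
    osc_majorant (frame_kernel mu ip psi) w y * (r w)%:C) ->
  cmod (ip (psi y') g) <= 2 * cmod (cintegral mu (fun w : borel X =>
    osc_majorant (frame_kernel mu ip psi) w y * (r w)%:C)).
Proof.
move=> Ujy Ujy' gr [ire _].
rewrite (frame_reproducing completeH frame_psi y' g).
set K := frame_kernel mu ip psi.
pose s w := complex.Re (osc_majorant K w y * (r w)%:C).
apply: (@le_trans _ _ (2 * Rintegral mu setT (s : borel X -> R))).
  apply: cmod_cintegral_le => //; first exact: frame_kernel_cintegrable.
  move=> w; rewrite cmodM /s Re_mulc /= mulr0 subr0.
  by apply: ler_pM; rewrite ?cmod_ge0//; exact: osc_majorantP Ujy'.
rewrite ler_pM2l// (le_trans (ler_norm _))//.
exact: (normr_Re_le
  (cintegral mu (fun w : borel X => osc_majorant K w y * (r w)%:C))).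
Qed.

End Localization.

Lemma kernel_ae_all (R : realType) (X : ptopologicalType)
    (mu : {measure set (borel X) -> \bar R}) (P : X -> X -> Prop) :
  (forall x y, P x y) -> kernel_ae mu P.
Proof.
move=> PT; exists set0; split => //; last by move=> z; apply.
by rewrite /product_measure1 integral0_eq// => x _ /=; rewrite xsection0 measure0.
Qed.

(** Solidity of [A]. The bound is asked only where the composition converges absolutely, which
    [composable] ensures almost everywhere. *)
Lemma admissible_le_comp (R : realType) (X : ptopologicalType)
    (mu : {measure set (borel X) -> \bar R}) (A : set (X -> X -> R[i]))
    (nA : (X -> X -> R[i]) -> R) (k : X -> X -> R) (K L : X -> X -> R[i])
    (c : R) :
  admissible_algebra mu A nA -> 0 <= c ->
  measurable_fun setT (fun z : borel X * borel X => k z.1 z.2) ->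
  (forall x y, 0 <= k x y) -> A (kernel_comp mu K L) -> composable mu K L ->
  (forall x y, cintegrable mu (fun z : borel X => K x z * L z y) ->
    k x y <= c * cmod (kernel_comp mu K L x y)) ->
  A (fun x y => (k x y)%:C).
Proof.
move=> [bA _ sA] c0 mk k0 AKL cKL kKL.
apply: (sA _ _ _ (bsa_scale bA c%:C AKL) _).1; first exact: cmeasurable_real.
move: cKL; apply: kernel_ae_mono => x y cxy.
rewrite /kernel_scale cmodM !cmod_real (ger0_norm c0) (ger0_norm (k0 x y)).
exact: kKL.
Qed.

(** * Sampling the Gramian one variable at a time *)

Section MatrixLocalization.
Context {R : realType} {X : ptopologicalType} {H : lmodType R[i]}.
Variable mu : {measure set (borel X) -> \bar R}.
Variable ip : {dot H for Num.conj}.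
Hypothesis completeH : complete_space ip.
Variables (m : X -> X -> R) (hm : admissible_weight m).
Variables (A : set (X -> X -> R[i])) (nA : (X -> X -> R[i]) -> R).
Hypothesis hA : admissible_algebra mu A nA.
Hypothesis bimA : kernel_bimodule mu (Am mu m) A.
Variables psi phi : X -> H.
Hypothesis frame_psi : continuous_frame mu ip psi.
Hypothesis frame_phi : continuous_frame mu ip phi.
Hypothesis loc_psi_phi : localized ip A psi phi.
Context {I : choiceType}.
Variable U : I -> set X.
Hypothesis admU : admissible_covering U.
Hypothesis countI : countable [set: I].
Variable N : nat.
Hypothesis overlapU : forall z, [set i | U i z] #<= `I_N.
Local Notation Kpsi := (frame_kernel mu ip psi).
Local Notation Kphi := (frame_kernel mu ip phi).
Hypothesis maj_psi : Am mu m (osc_majorant U Kpsi).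
Hypothesis maj_phi : Am mu m (osc_majorant U Kphi).

Lemma indic_mul_supp (a : R) (i : I) (z : X) : ~ U i z -> a * \1_(U i) z = 0.
Proof. by move=> nUz; rewrite indicE memNset// mulr0. Qed.

Lemma indic_mul_le (a : R) (i : I) (z : X) : 0 <= a -> a * \1_(U i) z <= a.
Proof. by move=> a0; rewrite indicE; case: (_ \in _); rewrite ?mulr1 ?mulr0. Qed.

Lemma finite_overlap z : finite_set [set i | U i z].
Proof. by apply: card_le_finite (overlapU z) _; exact: finite_II. Qed.

Lemma measurable_indic_cover i : measurable_fun setT (\1_(U i) : borel X -> R).
Proof. by apply: measurable_indic; exact: cov_measurable. Qed.

(** At most [N] members contain [w], and each term costs the factor [2] of [frame_pointwise_le],
    whence the constant [N * 2] in front of the composition of [absG] with the majorant. *)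
Lemma half_sampled_gramian (y : I -> X) : (forall j, U j (y j)) ->
  A (fun z w => (\sum_(j \in [set: I])
       cmod (ip (phi (y j)) (psi z)) * \1_(U j) w)%:C).
Proof.
move=> hy.
pose absG : X -> X -> R[i] := fun z w => (cmod (gramian ip psi phi z w))%:C.
have AabsG : A absG.
  apply: (adm_solid hA _ loc_psi_phi _).1.
    apply: cmeasurable_real; apply: measurable_cmod.
    exact: bsa_measurable (adm_banach hA) _ loc_psi_phi.
  by apply: kernel_ae_all => z w; rewrite /absG cmod_real ger0_norm ?cmod_ge0.
have maj0 := bim_composabler bimA AabsG maj_phi.
have Acomp := bim_right bimA AabsG maj_phi.
apply: (admissible_le_comp (c := N%:R * 2) hA _ _ _ Acomp maj0) => //.
- apply: (measurable_fsbig (T := (borel X * borel X)%type)) => //.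
    move=> j; apply: measurable_funM.
      have mj := measurable_cmod (frame_square_integrable frame_psi (phi (y j))).1.
      exact: (measurableT_comp mj (@measurable_fst _ _ (borel X) (borel X))).
    exact: (measurableT_comp (measurable_indic_cover j)
      (@measurable_snd _ _ (borel X) (borel X))).
  move=> z; apply: sub_finite_set (finite_overlap z.2) => j /=.
  by apply: contra_neqP => nU; rewrite indic_mul_supp.
- by move=> z w; apply: fsumr_ge0 => j _; rewrite mulr_ge0 ?cmod_ge0.
move=> z w czw; rewrite -mulrA; apply: fsbig_le_card (overlapU w) _ _ _.
- by rewrite mulr_ge0 ?cmod_ge0.
- move=> j Ujw; rewrite (le_trans (indic_mul_le _ _ _)) ?cmod_ge0//.
  have E : (fun u : borel X => absG z u * osc_majorant U Kphi u w) =
    (fun u : borel X => osc_majorant U Kphi u w * (cmod (ip (phi u) (psi z)))%:C).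
    by apply/funext => u; rewrite mulrC.
  rewrite /kernel_comp E; apply: (frame_pointwise_le completeH frame_phi Ujw) => //.
  by rewrite -E.
- by move=> j; exact: indic_mul_supp.
Qed.

(** The second sampling applies [frame_pointwise_le] with the half-sampled kernel as [r]. At most
    [N] indices [i], at most [N] indices [j] and the factor [2] make up the constant. *)
Lemma sampled_gramian (x y : I -> X) :
  (forall i, U i (x i)) -> (forall j, U j (y j)) ->
  A (matrix_kernel U (gramian ip (fun i => psi (x i)) (fun i => phi (y i)))).
Proof.
move=> hx hy; have AT := half_sampled_gramian hy.
set T := (X in A X) in AT.
(* Transposed so that the sampled variable comes first and the composition with [T] integrates over
   the other one. *)
have majT := Am_transpose hm maj_psi.
have cT := bim_composablel bimA majT AT.
have AcT := bim_left bimA majT AT.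
set F := fun (u v : X) (i j : I) =>
  cmod (ip (phi (y j)) (psi (x i))) * \1_(U i) u * \1_(U j) v.
have F0 u v i j : 0 <= F u v i j by rewrite /F !mulr_ge0 ?cmod_ge0.
have FU u v i j : ~ U i u -> F u v i j = 0.
  by move=> nU; rewrite /F (indic_mul_supp _ nU) mul0r.
have FV u v i j : ~ U j v -> F u v i j = 0 by move=> nU; rewrite /F indic_mul_supp.
apply: (admissible_le_comp (c := N%:R * (N%:R * 2)) hA _ _ _ AcT cT) => //.
- apply: (measurable_fsbig (T := (borel X * borel X)%type)) => //.
  + by rewrite -setXTT; exact: countableX.
  + move=> p; apply: measurable_funM; first apply: measurable_funM.
    * exact: measurable_cst.
    * exact: (measurableT_comp (measurable_indic_cover p.1)
        (@measurable_fst _ _ (borel X) (borel X))).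
    * exact: (measurableT_comp (measurable_indic_cover p.2)
        (@measurable_snd _ _ (borel X) (borel X))).
  + move=> z; apply: (@sub_finite_set _ _ ([set i | U i z.1] `*` [set j | U j z.2])).
      move=> [i j] /= Fz; split; apply: contrapT => nU; move/eqP: Fz; apply.
        exact: (FU z.1 z.2).
      exact: (FV z.1 z.2).
    by apply: finite_setX; exact: finite_overlap.
- by move=> u v; apply: fsumr_ge0 => p _; exact: (F0 u v p.1 p.2).
move=> u v cuv.
(* Restriction to the finite rectangle of contributing pairs lets the sum be split into iterated
   sums. *)
rewrite -(@fsbig_widen _ _ _ _ ([set i | U i u] `*` [set j | U j v]))//;
  last first.
  move=> [i j] [_ nUU] /=; have [Uiu|nUiu] := pselect (U i u).
    by apply: (FV u v) => Ujv; apply: nUU.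
  exact: (FU u v).
have := @pair_fsbig R 0 _ I I [set i | U i u] [set j | U j v] (F u v)
  (finite_overlap u) (finite_overlap v).
move=> /= <-; rewrite -2!mulrA.
apply: fsbig_le_card (overlapU u) _ _ _.
- by rewrite !mulr_ge0 ?cmod_ge0.
- move=> i Uiu; apply: fsbig_le_card (overlapU v) _ _ _.
  + by rewrite mulr_ge0 ?cmod_ge0.
  + move=> j Ujv; rewrite /F (le_trans (indic_mul_le _ _ _))//.
      by rewrite mulr_ge0 ?cmod_ge0.
    rewrite (le_trans (indic_mul_le _ _ _)) ?cmod_ge0//.
    (* Conjugation moves [psi] into the first slot, where the reproducing formula applies. *)
    rewrite ipC cmodJ.
    apply: (frame_pointwise_le completeH frame_psi Uiu) => // w.
    rewrite ipC cmodJ.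
    (* As [v] lies in [U j], this modulus is one of the nonnegative terms of the half-sampled
       sum. *)
    apply: (le_trans _ (le_fsbig
      (F := fun j => cmod (ip (phi (y j)) (psi w)) * \1_(U j) v) j
      (finite_overlap v) _ _)).
    * by rewrite indicE mem_set// mulr1.
    * by move=> k; rewrite mulr_ge0 ?cmod_ge0.
    * by move=> k; exact: indic_mul_supp.
  + by move=> j; exact: FV.
- by move=> i nUiu; rewrite fsbig1// => j _; exact: FU.
Qed.

End MatrixLocalization.

Local Close Scope card_scope.

Theorem theorem6p3 (R : realType) (H : lmodType R[i])
    (ip : {dot H for Num.conj}) (X : ptopologicalType)
    (mu : {measure set (borel X) -> \bar R})
    (hH : separable_hilbert ip)
    (hausdorffX : hausdorff_space X)
    (lcompactX : locally_compact [set: X])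
    (scompactX : @sigma_compact X)
    (radon_mu : radon_measure mu)
    (supp_mu : measure_support mu = [set: X])
    (m : X -> X -> R) (hm : admissible_weight m)
    (A : set (X -> X -> R[i])) (nA : (X -> X -> R[i]) -> R)
    (hA : admissible_algebra mu A nA)
    (bimA : kernel_bimodule mu (Am mu m) A)
    (psi phi : X -> H)
    (frame_psi : continuous_frame mu ip psi)
    (frame_phi : continuous_frame mu ip phi)
    (loc_psi_phi : localized ip A psi phi)
    (R_psi : Am mu m (frame_kernel mu ip psi))
    (R_phi : Am mu m (frame_kernel mu ip phi))
    (I : choiceType) (U : I -> set X)
    (modU : moderate_admissible_covering mu U)
    (delta : R) (delta_gt0 : 0 < delta)
    (D_psi : property_D mu U ip delta m psi)
    (D_phi : property_D mu U ip delta m phi)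
    (x y : I -> X)
    (hx : forall i, U i (x i)) (hy : forall i, U i (y i)) :
  localized ip (matrix_algebra U A)
    (fun i => psi (x i)) (fun i => phi (y i)).
Proof.
have [N overlapU] := covering_overlap (mod_admissible modU).
apply: (sampled_gramian hH.1 hm hA bimA frame_psi frame_phi loc_psi_phi
  (mod_admissible modU) _ overlapU _ _ hx hy).
- exact: covering_countable modU.
- exact: osc_majorant_Am D_psi.
- exact: osc_majorant_Am D_phi.
Qed.
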